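(* For $d\in\mathbb{N}$ let $$\Gamma_{1:d}=\sup_{n\ge1}\ \max_{\varnothing\ne u\subseteq\{1,\dots,d\}}\ \sup_{\boldsymbol{k}\in\mathbb{N}_0^u}G_{u,\boldsymbol{k}}(n),$$ where $G_{u,\boldsymbol{k}}(n)$ are the gain coefficients of the Halton points. Then for every $\epsilon>0$, it is not the case that $\Gamma_{1:d}=O((\log d)^{1-\epsilon})$ as $d\to\infty$.
   Context: $\mathbb{N}=\{1,2,\dots\}$, $\mathbb{N}_0=\mathbb{N}\cup\{0\}$. For $j\in\mathbb{N}$, $b_j$ is the $j$-th prime ($b_1=2,b_2=3,b_3=5,\dots$). For $i\in\mathbb{N}_0$ write $i=\sum_{\ell\ge1}a_{ij\ell}b_j^{\ell-1}$ with base-$b_j$ digits $a_{ij\ell}\in\{0,\dots,b_j-1\}$; the (unscrambled) Halton points are $\boldsymbol{a}_i=(a_{i1},\dots,a_{id})\in[0,1)^d$, $i\in\mathbb{N}_0$, with $a_{ij}=\sum_{\ell\ge1}a_{ij\ell}b_j^{-\ell}$. For $u\subseteq\{1,\dots,d\}$, $\mathbb{N}_0^u$ is the set of vectors $\boldsymbol{k}=(k_j)_{j\in u}$ of nonnegative integers indexed by $u$. For non-empty $u\subseteq\{1,\dots,d\}$, $\boldsymbol{k}\in\mathbb{N}_0^u$ and $n\in\mathbb{N}$, the gain coefficient is $$G_{u,\boldsymbol{k}}(n)=\frac1n\prod_{j\in u}\frac1{b_j-1}\ \sum_{i=0}^{n-1}\sum_{i'=0}^{n-1}\prod_{j\in u}\Bigl(b_j\mathbf{1}\{\lfloor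 b_j^{k_j+1}a_{ij}\rfloor=\lfloor b_j^{k_j+1}a_{i'j}\rfloor\}-\mathbf{1}\{\lfloor b_j^{k_j}a_{ij}\rfloor=\lfloor b_j^{k_j}a_{i'j}\rfloor\}\Bigr),$$ where $\mathbf{1}\{A\}$ is $1$ if $A$ holds and $0$ otherwise. *)

(* Defs.v *)
From HB Require Import structures.
From mathcomp Require Import all_boot all_order all_algebra.
From mathcomp Require Import all_classical all_reals all_analysis.

Set Implicit Arguments.
Unset Strict Implicit.
Unset Printing Implicit Defensive.

Import Order.TTheory GRing.Theory Num.Theory.
Import numFieldNormedType.Exports.

Local Open Scope ring_scope.

Lemma ex_prime_gt (n : nat) : exists p, (n < p)%N && prime p.
Proof. by have [p np pp] := prime_above n; exists p; rewrite np. Qed.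

Definition next_prime (n : nat) : nat := ex_minn (ex_prime_gt n).

(* Coordinates are indexed from 0 (by 'I_d), so base j is the (j+1)-st prime:
   base 0 = 2, base 1 = 3, base 2 = 5, ... *)
Definition base (j : nat) : nat := iter j next_prime 2%N.

(* Coefficient of b ^ (l - 1) in the base-b expansion of i, for l >= 1. *)
Definition digit (b i l : nat) : nat := ((i %/ b ^ l.-1) %% b)%N.

(* j-th coordinate of the i-th Halton point; the series has finitely many
   nonzero terms. *)
Definition halton (R : realType) (i j : nat) : R :=
  limn (fun N : nat =>
    \sum_(1 <= l < N) (digit (base j) i l)%:R / (base j)%:R ^+ l : R).

Definition same_cell (R : realType) (j k i i' : nat) : bool :=
  Num.floor ((base j)%:R ^+ k * halton R i j)
    == Num.floor ((base j)%:R ^+ k * halton R i' j).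

(* A vector indexed by u is represented by a function on all of 'I_d, of which
   only the values on u are used. *)
Definition gain (R : realType) (d : nat) (u : {set 'I_d}) (k : 'I_d -> nat)
    (n : nat) : R :=
  n%:R^-1 * (\prod_(j in u) ((base j)%:R - 1)^-1) *
  \sum_(0 <= i < n) \sum_(0 <= i' < n) \prod_(j in u)
    ((base j)%:R * (same_cell R j (k j).+1 i i')%:R
     - (same_cell R j (k j) i i')%:R).

(* Extended-real valued, so that an infinite supremum is not silently
   replaced by a default value. *)
Definition Gamma (R : realType) (d : nat) : \bar R :=
  ereal_sup [set
    \big[maxe/-oo%E]_(u : {set 'I_d} | u != finset.set0)
      ereal_sup [set (gain R u k n)%:E | k in [set: 'I_d -> nat]]
  | n in [set n : nat | (1 <= n)%N]]%classic.

(* f = O(g) at infinity; MathComp-Analysis's bigO does not apply to functions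
   with values in \bar R. In particular f is eventually finite. *)
Definition ereal_bigO (R : realType) (f : nat -> \bar R) (g : nat -> R) : Prop :=
  exists C : R, \forall d \near \oo%classic, (`|f d| <= (C * `|g d|)%:E)%E.

(* Main.v *)
Require Import Defs.
From mathcomp Require Import all_boot all_order all_algebra.
From mathcomp Require Import all_classical all_reals all_analysis.
From mathcomp Require Import ring lra zify.

Set Implicit Arguments.
Unset Strict Implicit.
Unset Printing Implicit Defensive.

Import Order.TTheory GRing.Theory Num.Theory.
Import numFieldNormedType.Exports.

Local Open Scope ring_scope.

(** Take n = (q - 1) / 2, where q is the product of the odd primes p among the
    bases, u the set of their indices and k = 0.  Since [p | 2n + 1] for each
    of them, expanding the product over the primes and applying the Chinese
    remainder theorem evaluates the double sum exactly: it is
    [\prod (p^2 - 1) / 4], so the gain is [\prod (p + 1) / (2 (q - 1))].  This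
    exceeds [\prod (1 + 1/p) / 2], which by Euler's product and
    [\prod_(j >= 2) (1 - 1/j^2) >= 1/2] is at least [ln d / 6]. *)

(** * Counting congruent pairs below [n] for moduli dividing [2n + 1] *)

Lemma sum_congr_window (e i n : nat) : (0 < e)%N ->
  (\sum_(n <= j < n + e) (i %% e == j %% e)%N = 1)%N.
Proof.
move=> e0; elim: n => [|n IH].
  rewrite add0n big_mkord (bigD1 (Ordinal (ltn_pmod i e0))) //= modn_mod eqxx.
  rewrite big1 // => j /eqP jne; case: eqP => // ij; case: jne.
  by apply: val_inj; rewrite /= ij modn_small.
(* Sliding the window by one trades [n] for [n + e], in the same class. *)
rewrite addSn big_nat_recr /=; last by lia.
by rewrite modnDr -IH [RHS]big_ltn 1?addnC //; lia.
Qed.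

Definition congr_pairs (e n : nat) : nat :=
  (\sum_(0 <= i < n) \sum_(0 <= j < n) (i %% e == j %% e)%N)%N.

(** Each of the [n] old rows gains one pair, and so does each of the [n] old columns; the new [e] by
    [e] block adds [e]. *)
Lemma congr_pairs_add (e n : nat) : (0 < e)%N ->
  (congr_pairs e (n + e) = congr_pairs e n + n + n + e)%N.
Proof.
move=> e0; rewrite /congr_pairs.
have split_row i : (\sum_(0 <= j < n + e) (i %% e == j %% e)%N =
    \sum_(0 <= j < n) (i %% e == j %% e)%N + 1)%N.
  by rewrite (big_cat_nat (n := n)) ?leq_addr //= sum_congr_window.
under eq_bigr do rewrite split_row.
rewrite big_split /= sum_nat_const_nat muln1 subn0.
rewrite (big_cat_nat (n := n)) ?leq_addr //=.
suff -> : (\sum_(n <= i < n + e) \sum_(0 <= j < n) (i %% e == j %% e) = n)%N by lia.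
rewrite exchange_big /=.
under eq_bigr => j _ do under eq_bigr => i _ do rewrite eq_sym.
under eq_bigr => j _ do rewrite sum_congr_window //.
by rewrite sum_nat_const_nat muln1 subn0.
Qed.

(** When [e * c = 2n + 1], taking [e] off [n] lowers the odd [c] by 2, down to [c = 1], where
    [n < e] and only diagonal pairs are congruent. The [+ 1] on the left avoids a truncated
    subtraction. *)
Lemma congr_pairs_dvd (e n : nat) : (e %| n.*2.+1)%N ->
  (4 * e * congr_pairs e n + 1 = 4 * n ^ 2 + e ^ 2)%N.
Proof.
case: e => [|e]; first by rewrite dvd0n.
move=> /dvdnP [c]; elim: c {-2}c (leqnn c) n => [|N IH] c cN n cn; first by lia.
have [c3|c3] := leqP 3 c.
  have -> : n = (n - e.+1 + e.+1)%N by nia.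
  set m := (n - e.+1)%N.
  have mE : n = (m + e.+1)%N by rewrite /m; nia.
  rewrite congr_pairs_add //.
  have /IH : (c - 2 <= N)%N by lia.
  move=> /(_ m); move: (congr_pairs _ _) => C CE.
  have := CE ltac:(nia); nia.
have c1 : c = 1%N by case: c cn c3 cN => [|[|[|c]]] //; lia.
move: cn; rewrite c1 mul1n => [[]] en.
have -> : congr_pairs e.+1 n = n.
  rewrite /congr_pairs -[RHS]muln1 -[n in RHS]subn0 -sum_nat_const_nat.
  apply: eq_big_nat => i /andP [_ lt_in].
  rewrite big_mkord (bigD1 (Ordinal lt_in)) //= eqxx.
  rewrite big1 // => j /eqP jne; case: eqP => // ij; case: jne.
  apply: val_inj => /=; move: ij; rewrite !modn_small //; have := ltn_ord j; lia.
rewrite -en; nia.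
Qed.

(* The modulus e carries the induction on s: splitting off p turns e into
   e * p or leaves it, and the term constant in e cancels in the difference. *)
Lemma sum_congr_prod (R : comPzRingType) (n : nat) (s : seq nat) (e : nat) :
  pairwise coprime (e :: s) -> (e * \prod_(p <- s) p %| n.*2.+1)%N ->
  4 * (\sum_(0 <= i < n) \sum_(0 <= i' < n)
     (e%:R * (i %% e == i' %% e)%N%:R *
      \prod_(p <- s) (p%:R * (i %% p == i' %% p)%N%:R - 1)))
  = (e%:R ^+ 2 * \prod_(p <- s) (p%:R ^+ 2 - 1)
      + (if s is [::] then 4 * n%:R ^+ 2 - 1 else 0) :> R).
Proof.
elim: s e => [|p s IH] e.
  rewrite big_nil muln1 => _ /congr_pairs_dvd /(congr1 (fun m => m%:R : R)).
  rewrite !natrD !natrM => E.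
  rewrite big_nil mulr1.
  transitivity (4 * e%:R * (congr_pairs e n)%:R : R); last by apply: (addIr 1); rewrite E; ring.
  rewrite /congr_pairs natr_sum -mulrA [in RHS]mulr_sumr; congr (_ * _).
  apply: eq_bigr => i _; rewrite natr_sum mulr_sumr; apply: eq_bigr => j _.
  by rewrite big_nil mulr1.
rewrite big_cons /= => /andP [/andP [ep es] /andP [ps ss]] dv.
have IH1 := IH (e * p)%N; have IH2 := IH e.
have {}IH1 := IH1 _ _; have {}IH2 := IH2 _ _.
transitivity (4 * (\sum_(0 <= i < n) \sum_(0 <= i' < n)
     ((e * p)%:R * (i %% (e * p) == i' %% (e * p))%N%:R *
      \prod_(p <- s) (p%:R * (i %% p == i' %% p)%N%:R - 1))) -
  4 * (\sum_(0 <= i < n) \sum_(0 <= i' < n)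
     (e%:R * (i %% e == i' %% e)%N%:R *
      \prod_(p <- s) (p%:R * (i %% p == i' %% p)%N%:R - 1))) : R).
  rewrite -mulrBr -sumrB; congr (_ * _); apply: eq_bigr => i _.
  rewrite -sumrB; apply: eq_bigr => j _.
  rewrite big_cons chinese_remainder // natrM -mulnb natrM; ring.
rewrite IH1 ?IH2 //=.
(* For empty [s] both sums carry the term [4 n^2 - 1], which cancels; otherwise neither does. *)
- rewrite big_cons natrM; case: s {IH IH1 IH2 es ps ss dv} => [|? ?]; ring.
- by rewrite es ss.
- by apply: dvdn_trans dv; rewrite dvdn_mul ?dvdn_mull.
- rewrite ss andbT; apply/allP => x xs; rewrite coprimeMl.
  by rewrite (allP es) // (allP ps).
- by rewrite -mulnA.
Qed.

(** * The bases as the increasing list of all primes *)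

Lemma prime_next_prime (n : nat) : prime (next_prime n).
Proof. by rewrite /next_prime; case: ex_minnP => m /andP []. Qed.

Lemma ltn_next_prime (n : nat) : (n < next_prime n)%N.
Proof. by rewrite /next_prime; case: ex_minnP => m /andP []. Qed.

Lemma next_prime_min (n p : nat) : prime p -> (n < p -> next_prime n <= p)%N.
Proof.
move=> pp np; rewrite /next_prime; case: ex_minnP => m _; apply.
by rewrite np.
Qed.

Lemma prime_base (j : nat) : prime (base j).
Proof. by case: j => // j; exact: prime_next_prime. Qed.

Lemma base_inj : injective base.
Proof.
apply: incn_inj; apply/leq_mono/(homo_ltn ltn_trans) => i.
exact: ltn_next_prime.
Qed.

Lemma ltn_base_id (j : nat) : (j.+1 < base j)%N.
Proof. by elim: j => // j IH; apply: leq_ltn_trans IH _; exact: ltn_next_prime. Qed.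

(** No prime lies strictly between consecutive bases, by minimality of [next_prime]. *)
Lemma prime_in_base (p d : nat) : prime p -> (p < base d)%N ->
  exists2 j, (j < d)%N & p = base j.
Proof.
move=> pp; elim: d => [|d IH]; first by move=> /(leq_trans (prime_gt1 pp)).
move=> pd; have [lt_pd|le_dp] := ltnP p (base d).
  by have [j jd ->] := IH lt_pd; exists j => //; apply: ltnW.
exists d => //; apply/eqP; rewrite eqn_leq le_dp andbT leqNgt.
by apply/negP => /(next_prime_min pp); rewrite leqNgt pd.
Qed.

(** * Cells of the Halton points at the two coarsest levels *)

Section Halton.
Variables (R : realType) (j : nat).
Let b := base j.

Definition halton_psum (i N : nat) : R :=
  \sum_(1 <= l < N) (digit b i l)%:R / b%:R ^+ l.

(** Multiplying by [b] shifts the digits: the first leaves the fractional part, and the rest are the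
    digits of [i %/ b]. The bound is exclusive, so [N.+2] guarantees a first digit. *)
Lemma halton_psumS (i N : nat) :
  b%:R * halton_psum i N.+2 = (i %% b)%:R + halton_psum (i %/ b) N.+1.
Proof.
have b0 : b%:R != 0 :> R by rewrite pnatr_eq0 -lt0n prime_gt0 ?prime_base.
rewrite /halton_psum big_ltn // mulrDr /digit /= expr1 expn0 divn1.
congr (_ + _); first by rewrite mulrCA divff ?mulr1.
rewrite big_add1 /= mulr_sumr; apply: eq_big_nat => -[|l] //= _.
rewrite expnS -divnMA mulrCA exprS invfM; congr (_ * _).
by rewrite mulrA divff ?mul1r.
Qed.

Lemma halton_psum_bound (i N : nat) : 0 <= halton_psum i N < 1.
Proof.
have b0 : 0 < b%:R :> R by rewrite ltr0n prime_gt0 ?prime_base.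
case: N => [|N]; first by rewrite /halton_psum big_geq // lexx ltr01.
elim: N i => [|N IH] i; first by rewrite /halton_psum big_geq // lexx ltr01.
have /andP [h0 h1] := IH (i %/ b)%N.
have m : (i %% b)%:R + 1 <= b%:R :> R.
  by rewrite natr1 ler_nat ltn_pmod // prime_gt0 ?prime_base.
have m0 : 0 <= (i %% b)%:R :> R by [].
rewrite -(pmulr_rge0 _ b0) -(ltr_pM2l b0) halton_psumS mulr1.
by apply/andP; split; lra.
Qed.

(** For [l >= i + 2] the digit vanishes, as [i < l - 1 < b ^ (l - 1)], so the partial sums are
    constant from there on. *)
Lemma haltonE (i N : nat) : (i.+2 <= N)%N -> halton R i j = halton_psum i N.
Proof.
have stable M : (i.+2 <= M)%N -> halton_psum i M = halton_psum i i.+2.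
  move=> iM; rewrite /halton_psum (big_cat_nat (n := i.+2)) //=.
  rewrite [X in _ + X]big_nat [X in _ + X]big1 ?addr0 // => l /andP [il _].
  rewrite /digit divn_small ?mod0n ?mul0r //.
  apply: leq_ltn_trans (_ : l.-1 < _)%N; first by lia.
  by apply: ltn_expl; rewrite prime_gt1 ?prime_base.
move=> iN; rewrite stable //; apply/cvg_lim => //.
apply: cvg_near_cst; exists i.+2 => // M /= iM; exact: stable.
Qed.

Lemma floor_halton (i : nat) : Num.floor (halton R i j) = 0.
Proof.
by apply: floor_def; rewrite (haltonE (leqnn _)) add0r halton_psum_bound.
Qed.

Lemma floor_base_halton (i : nat) : Num.floor (b%:R * halton R i j) = (i %% b)%:Z.
Proof.
apply: floor_def; rewrite (haltonE (leqnSn _)) halton_psumS.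
have /andP [h0 h1] := halton_psum_bound (i %/ b) i.+2.
rewrite intrD -!pmulrn.
by apply/andP; split; lra.
Qed.

Lemma same_cell0 (i i' : nat) : same_cell R j 0 i i'.
Proof. by rewrite /same_cell expr0 !mul1r !floor_halton. Qed.

(** Together with level 0, where all points share one cell, this turns each factor of the gain at
    [k = 0] into [p] times a congruence indicator modulo [p], minus 1. *)
Lemma same_cell1 (i i' : nat) : same_cell R j 1 i i' = (i %% b == i' %% b)%N.
Proof. by rewrite /same_cell expr1 !floor_base_halton. Qed.

End Halton.

(** * Smooth numbers, Euler's product and the harmonic sum *)

(** [primes 0] is empty, so 0 counts as smooth; the sums below start at 1. *)
Definition smooth (s : seq nat) (m : nat) : bool := all (mem s) (primes m).


Lemma sum_dvd (V : nmodType) (p N : nat) (F : nat -> V) : (0 < p)%N ->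
  \sum_(1 <= m < N.+1 | (p %| m)%N) F m
  = \sum_(1 <= k < (N %/ p).+1) F (p * k)%N.
Proof.
move=> p0; rewrite big_mkcond; elim: N => [|N IH]; first by rewrite div0n !big_geq.
rewrite big_nat_recr //= IH divnS //.
case: (boolP (p %| N.+1)%N) => [/dvdnP [c Nc]|_] /=; last by rewrite addr0.
have -> : (N %/ p = c.-1)%N.
  have := divnS N p0; rewrite Nc mulnK // dvdn_mull //=; lia.
case: c Nc => [|c] Nc //.
by rewrite Nc /= add1n [RHS]big_nat_recr //= mulnC.
Qed.

(** One half of Euler's product, adjoining one prime at a time: multiples of [p] carry at most [1/p]
    of the full sum, so the factor [1 - 1/p] leaves at most the terms not divisible by [p], which
    are smooth over [s]. *)
Lemma sum_inv_smooth_le (R : realFieldType) (s : seq nat) (N : nat) :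
  all prime s ->
  (\sum_(1 <= m < N.+1) (smooth s m)%:R / m%:R) * \prod_(p <- s) (1 - p%:R^-1)
    <= 1 :> R.
Proof.
elim: s N => [|p s IH] N /=.
  rewrite big_nil mulr1 => _.
  have sm1 m : smooth [::] m -> (m <= 1)%N.
    rewrite /smooth; case: m => [|[|m]] //.
    move=> /allP /(_ (pdiv m.+2)); rewrite mem_primes pdiv_prime // pdiv_dvd /=.
    by move=> /(_ isT).
  case: N => [|N]; first by rewrite big_geq.
  rewrite big_ltn //= mul1r invr1 big_nat big1 ?addr0 // => m /andP [m1 _].
  case: (boolP (smooth _ _)) => [/sm1|_]; last by rewrite mul0r.
  by rewrite leqNgt m1.
move=> /andP [pp ps]; have p0 := prime_gt0 pp.
apply: le_trans (IH N ps); rewrite big_cons mulrA ler_wpM2r //.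
  (* At 0 the convention [0^-1 = 0] gives the factor 1. *)
  apply: prodr_ge0 => -[|q] _; first by rewrite invr0 subr0.
  by rewrite subr_ge0 invf_le1 ?ler1n.
rewrite mulrBr mulr1 lerBlDr.
pose F m : R := (smooth (p :: s) m)%:R / m%:R.
have F0 m : 0 <= F m by rewrite divr_ge0.
have split m : F m <= (smooth s m)%:R / m%:R + (if (p %| m)%N then F m else 0).
  case: ifP => [_|pm]; first by rewrite lerDr divr_ge0.
  rewrite addr0 /F ler_wpM2r ?invr_ge0 // ler_nat /smooth.
  case: (boolP (all (mem s) (primes m))) => [_|ns]; first by case: all.
  rewrite leqn0 eqb0; apply: contra ns => /allP sp; apply/allP => q qm.
  have := sp _ qm; rewrite inE => /orP [/eqP qp|//].
  by move: qm; rewrite qp mem_primes pm !andbF.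
apply: le_trans (ler_sum _ (fun m _ => split m)) _.
rewrite big_split /= lerD2l -big_mkcond sum_dvd // mulr_suml.
have Fp k : (0 < k)%N -> F (p * k)%N <= F k / p%:R.
  move=> k0; rewrite /F natrM invfM mulrAC mulrA ler_wpM2r ?invr_ge0 //.
  rewrite ler_wpM2r ?invr_ge0 // ler_nat /smooth.
  case: (boolP (all _ (primes k))) => [_|ns]; first by case: all.
  rewrite leqn0 eqb0; apply: contra ns => /allP sp; apply/allP => q qk.
  by apply: sp; rewrite primesM // qk orbT.
apply: (@le_trans _ _ (\sum_(1 <= k < (N %/ p).+1) F k / p%:R)).
  by apply: ler_sum_nat => k /andP [k0 _]; exact: Fp.
rewrite [leRHS](big_cat_nat (n := (N %/ p).+1)) ?ltnS ?leq_div //=.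
by rewrite lerDl sumr_ge0 // => k _; rewrite divr_ge0.
Qed.

(** Telescoping: [1 - 1/m^2 = ((m - 1)/m) ((m + 1)/m)] with [m = j + 2]. *)
Lemma prod_one_sub_inv_sq (R : realFieldType) (d : nat) :
  \prod_(0 <= j < d) (1 - (j.+2%:R ^+ 2)^-1) = (d.+2%:R / d.+1%:R) / 2 :> R.
Proof.
elim: d => [|d IH].
  by rewrite big_geq // divr1 divff // pnatr_eq0.
rewrite big_nat_recr //= IH.
have h (k : nat) : k.+1%:R = k%:R + 1 :> R by rewrite natr1.
have h0 := ler0n R d.
rewrite !h; field; apply/andP; split; apply/lt0r_neq0; lra.
Qed.

(** Adds up [ln ((m + 1)/m) <= 1/m], an instance of [ln (1 + t) <= t]. *)
Lemma ln_le_harmonic (R : realType) (d : nat) :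
  ln (d.+1%:R : R) <= \sum_(1 <= m < d.+1) m%:R^-1.
Proof.
elim: d => [|d IH]; first by rewrite big_geq // ln1.
rewrite big_nat_recr //=; apply: (le_trans _ (lerD IH (lexx _))).
have d0 : 0 < d.+1%:R :> R by rewrite ltr0n.
rewrite -lerBlDl -ln_div ?posrE ?ltr0n //.
have -> : d.+2%:R / d.+1%:R = 1 + d.+1%:R^-1 :> R.
  by rewrite -natr1 mulrDl divff ?mul1r ?lt0r_neq0.
by apply: le_ln1Dx; apply: lt_trans (_ : _ < 0) _; rewrite ?ltrN10 ?invr_gt0.
Qed.

(** From [ln (d + 1) * prod (1 - 1/p) <= 1] and [prod (1 - 1/p^2) >= 1/2], the product including the
    prime 2 is at least [ln (d + 1) / 2]; removing the factor [3/2] of that prime turns [1/2] into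
    [1/3]. *)
Lemma prod_one_add_inv_base (R : realType) (d : nat) :
  ln (d.+1%:R : R) / 3 <= \prod_(1 <= j < d.+1) (1 + (base j)%:R^-1).
Proof.
have ln_le : ln (d.+1%:R : R) * \prod_(0 <= j < d.+1) (1 - (base j)%:R^-1) <= 1.
  have pr : all prime (map base (iota 0 d.+1)).
    by apply/allP => _ /mapP [j _ ->]; exact: prime_base.
  have := sum_inv_smooth_le R d pr; rewrite big_map; apply: le_trans.
  rewrite ler_wpM2r //.
    apply: prodr_ge0 => j _; rewrite subr_ge0 invf_le1 ?ler1n ?ltr0n //;
      exact/prime_gt0/prime_base.
  apply: le_trans (ln_le_harmonic R d) _.
  rewrite big_nat [leRHS]big_nat; apply: ler_sum => m /andP [m1 md].
  (* Prime factors of [m <= d] are below [base d.+1], hence among the first [d.+1] bases. *)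
  suff -> : smooth (map base (iota 0 d.+1)) m by rewrite mul1r.
  apply/allP => q; rewrite mem_primes => /and3P [pq m0 qm].
  have : (q < base d.+1)%N.
    by apply: leq_ltn_trans (dvdn_leq m0 qm) _; apply: ltn_trans (ltn_base_id _); lia.
  move=> /(prime_in_base pq) [j jd ->]; apply/mapP; exists j => //.
  by rewrite mem_iota.
have half : 1 / 2 <= \prod_(0 <= j < d.+1) (1 - (base j)%:R^-1) *
    \prod_(0 <= j < d.+1) (1 + (base j)%:R^-1) :> R.
  rewrite -big_split /=.
  (* Since [base j >= j + 2], the integers from 2 on give smaller factors than the primes. *)
  apply: (@le_trans _ _ (\prod_(0 <= j < d.+1) (1 - (j.+2%:R ^+ 2)^-1) : R)).
    rewrite prod_one_sub_inv_sq ler_wpM2r ?invr_ge0 //.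
    by rewrite ler_pdivlMr ?ltr0n // mul1r ler_nat.
  apply: ler_prod => j _; apply/andP; split.
    by rewrite subr_ge0 invf_le1 ?exprn_gt0 ?ltr0n // exprn_ege1 ?ler1n.
  rewrite -subr_sqr expr1n exprVn lerD2l lerN2.
  have b0 : 0 < (base j)%:R :> R by rewrite ltr0n prime_gt0 ?prime_base.
  rewrite lef_pV2 ?posrE ?exprn_gt0 ?ltr0Sn //.
  by rewrite lerXn2r ?nnegrE // ler_nat; exact: ltn_base_id.
move: half; rewrite [X in _ <= _ * X]big_ltn //=.
set a := \prod_(0 <= j < d.+1) (1 - (base j)%:R^-1) in ln_le *.
set c := \prod_(1 <= j < d.+1) (1 + (base j)%:R^-1).
set l := ln _ in ln_le *; move=> half.
have c0 : 0 <= c by apply: prodr_ge0 => j _; rewrite addr_ge0 ?invr_ge0.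
have l0 : 0 <= l by apply: ln_ge0; rewrite ler1n.
have h1 := ler_wpM2l l0 half; have h2 := ler_wpM2r c0 ln_le.
lra.
Qed.

(** * Lower bounds for the gain and for [Gamma] *)

(** Index 0, the prime 2, stays out of the set because [q = 2n + 1] must be odd; [0 < d] leaves at
    least one odd prime, so [n > 0]. The [1/6] is the [1/3] of the product over odd bases times
    [1/2]. *)
Lemma ler_gain (R : realType) (d : nat) : (0 < d)%N ->
  exists2 n, (0 < n)%N &
    ln (d.+1%:R : R) / 6 <= gain R [set j : 'I_d.+1 | (0 < j)%N] (fun=> 0%N) n.
Proof.
move=> d0.
pose P := [seq base j | j <- index_iota 1 d.+1].
have Pprime p : p \in P -> prime p && odd p.
  move=> /mapP [j]; rewrite mem_index_iota => /andP [j1 _] ->.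
  rewrite prime_base; case: (even_prime (prime_base j)) => // b2.
  by have := ltn_base_id j; rewrite b2 !ltnS leqNgt j1.
pose q := (\prod_(p <- P) p)%N.
have q_odd : odd q.
  rewrite /q big_seq; elim/big_ind: _ => // [x y ox oy|p /Pprime /andP []] //.
  by rewrite oddM ox.
have q3 : (2 < q)%N.
  rewrite /q big_map big_ltn //.
  apply: leq_trans (_ : 3 * 1 <= _)%N => //; apply: leq_mul.
    exact: ltn_base_id.
  by apply: prodn_gt0 => j; exact/prime_gt0/prime_base.
have qE : q = (q./2).*2.+1 by rewrite -[LHS]odd_double_half q_odd.
have n0 : (0 < q./2)%N by lia.
exists q./2 => //; set n := q./2 in qE n0 *.
have prodP (F : nat -> R) :
    \prod_(j in [set j : 'I_d.+1 | (0 < j)%N]) F (base j) = \prod_(p <- P) F p.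
  rewrite big_map.
  under eq_bigl do rewrite inE.
  rewrite -(big_mkord (fun j => 0 < j)%N (fun j => F (base j))).
  rewrite big_mkcond big_ltn //= mul1r big_nat [RHS]big_nat.
  by apply: eq_bigr => j /andP [-> _].
have coP : pairwise coprime (1%N :: P).
  rewrite /= [X in _ && X]pairwise_map; apply/andP; split.
    by apply/allP => x _; exact: coprime1n.
  apply/(pairwiseP 0%N) => i j; rewrite !inE !size_iota => ilt jlt ij /=.
  rewrite prime_coprime ?prime_base // dvdn_prime2 ?prime_base //.
  by rewrite (inj_eq base_inj) !nth_iota //; lia.
(* The modulus [e = 1] makes the leading congruence trivial, which leaves the double sum of the
   gain. *)
have := @sum_congr_prod R n P 1 coP; rewrite mul1n -/q -qE dvdnn => /(_ isT).
have -> : (if P is [::] then 4 * n%:R ^+ 2 - 1 else 0 : R) = 0.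
  have : size P != 0%N by rewrite size_map size_iota; lia.
  by case: (P).
rewrite expr1n mul1r addr0; set S := \sum_(0 <= i < n) _ => SE.
have -> : gain R [set j : 'I_d.+1 | (0 < j)%N] (fun=> 0%N) n =
    n%:R^-1 * (\prod_(p <- P) (p%:R - 1)^-1) * S.
  rewrite /gain (prodP (fun p => (p%:R - 1)^-1)); congr (_ * _).
  apply: eq_bigr => i _; apply: eq_bigr => i' _.
  rewrite !modn1 eqxx !mul1r.
  rewrite -(prodP (fun p => p%:R * (i %% p == i' %% p)%N%:R - 1)).
  by apply: eq_bigr => j _; rewrite same_cell0 same_cell1.
have p1 p : p \in P -> 0 < p%:R - 1 :> R.
  by move=> /Pprime /andP [/prime_gt1 p1 _]; rewrite subr_gt0 ltr1n.
have SE' : S = (\prod_(p <- P) (p%:R - 1)) * (\prod_(p <- P) (p%:R + 1)) / 4.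
  rewrite -big_split /=.
  under eq_bigr do rewrite -subr_sqr expr1n.
  by rewrite -SE mulrC mulKf // pnatr_eq0.
have A0 : 0 < \prod_(p <- P) (p%:R - 1) :> R.
  by rewrite big_seq; apply: prodr_gt0 => p /p1.
have B0 : 0 <= \prod_(p <- P) (p%:R + 1) :> R.
  by apply: prodr_ge0 => p _; rewrite addr_ge0.
(* The gain is [prod (p + 1) / (4n)], and [2n <= q]. *)
rewrite SE' prodfV; apply: (@le_trans _ _ ((\prod_(p <- P) (p%:R + 1)) / q%:R / 2)).
  have := prod_one_add_inv_base R d.
  have -> : \prod_(1 <= j < d.+1) (1 + (base j)%:R^-1) =
      \prod_(p <- P) (p%:R + 1) / q%:R :> R.
    rewrite /q natr_prod -prodf_div big_map; apply: eq_bigr => j _.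
    by rewrite mulrDl mul1r divff // pnatr_eq0 -lt0n prime_gt0 ?prime_base.
  by lra.
set A := \prod_(p <- P) (p%:R - 1) in A0 *.
set B := \prod_(p <- P) (p%:R + 1) in B0 *.
have n1 : 0 < n%:R :> R by rewrite ltr0n.
have -> : n%:R^-1 / A * (A * B / 4) = B / (2 * n%:R) / 2.
  by field; rewrite !lt0r_neq0.
rewrite ler_wpM2r ?invr_ge0 // ler_wpM2l // lef_pV2 ?posrE ?mulr_gt0 ?ltr0n //.
  by rewrite -natrM ler_nat qE -mul2n.
by rewrite qE.
Qed.

Lemma Gamma_ge (R : realType) (d : nat) : (0 < d)%N ->
  ((ln (d.+1%:R : R) / 6)%:E <= Gamma R d.+1)%E.
Proof.
move=> d0; have [n n0 le_gain] := ler_gain R d0.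
pose u := [set j : 'I_d.+1 | (0 < j)%N].
apply: le_trans (_ : ((gain R u (fun=> 0%N) n)%:E <= _)%E); first by rewrite lee_fin.
apply: (@le_trans _ _ (\big[maxe/-oo%E]_(u : {set 'I_d.+1} | u != finset.set0)
      ereal_sup [set (gain R u k n)%:E | k in [set: 'I_d.+1 -> nat]]%classic)).
  apply: (le_trans _ (@le_bigmax_cond _ _ _ _ u _ _ _)).
    by apply: ereal_sup_ubound; exists (fun=> 0%N).
  by apply/set0Pn; exists ord_max; rewrite inE.
by apply: ereal_sup_ubound; exists n.
Qed.

(** As [ln d / 6] is a lower bound for [Gamma], such a [C] would force [(ln d)^eps <= 6 C] for all
    large [d], but the left side is unbounded. *)
Theorem corollary4 (R : realType) (eps : R) (heps : 0 < eps) :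
  ~ ereal_bigO (Gamma R) (fun d : nat => ln (d%:R : R) `^ (1 - eps)).
Proof.
case=> C [N _ bound].
(* Chosen so that [y^eps] strictly exceeds [6 C]. *)
pose y : R := (6 * `|C| + 1) `^ eps^-1.
have yC : y `^ eps = 6 * `|C| + 1.
  by rewrite -powRrM mulVf ?lt0r_neq0 // powRr1 // addr_ge0 ?mulr_ge0.
have [M yM] : exists M : nat, expR y < M%:R.
  by exists (Num.trunc (expR y)).+1; exact: truncnS_gt.
(* Passes both the threshold [N] of the assumed bound and [exp y]. *)
pose d := (maxn N M).+1.
have y0 : 0 <= y by exact: powR_ge0.
set x := ln (d.+1%:R : R).
have yx : y < x.
  rewrite -ltr_expR lnK ?posrE ?ltr0n //; apply: lt_le_trans yM _.
  by rewrite ler_nat /d; lia.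
have x0 : 0 < x by exact: le_lt_trans yx.
have := bound d.+1; rewrite /= -/x => /(_ ltac:(rewrite /d; lia)) le_C.
have : ((x / 6)%:E <= (C * `|x `^ (1 - eps)|)%:E)%E.
  apply: le_trans le_C; apply: le_trans (lee_abs _); exact: Gamma_ge.
rewrite lee_fin ger0_norm ?powR_ge0 //.
have x1 : x `^ (1 - eps) * x `^ eps = x.
  by rewrite -powRD ?subrK ?powRr1 ?ltW // lt0r_neq0 // implybT.
have z0 : 0 < x `^ (1 - eps) by rewrite powR_gt0.
(* Cancelling the positive factor [x^(1 - eps)] leaves [x^eps / 6 <= C]. *)
rewrite -[X in X / 6]x1 -mulrA [leRHS]mulrC ler_pM2l //.
have : y `^ eps <= x `^ eps.
  by apply: ge0_ler_powR; rewrite ?nnegrE // ltW.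
rewrite yC; have := ler_norm C; lra.
Qed.
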